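(* Let $d\ge 1$, let $K$ be the convex hull of $m\ge 2$ distinct points in $\mathbb{R}^d$, and let $n$ be the number of extreme points of $K$. If $X_1,X_2,\dots,X_{nd}\subseteq\mathbb{R}^d$ are sets each of whose convex hulls contains $K$, then there exist $x_1\in X_1,\dots,x_{nd}\in X_{nd}$ such that \[ K\subset\operatorname{conv}\{x_1,\dots,x_{nd}\}. \] Moreover, the number $nd$ of sets is optimal for the conclusion to hold: for every such $K$ there exist sets $X_1,\dots,X_{nd-1}\subseteq\mathbb{R}^d$, each of whose convex hulls contains $K$, such that no choice of $x_1\in X_1,\dots,x_{nd-1}\in X_{nd-1}$ satisfies $K\subset\operatorname{conv}\{x_1,\dots,x_{nd-1}\}$. *)

(* Defs.v *)
From HB Require Import structures.
From mathcomp Require Import all_boot all_order all_algebra finmap.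
From mathcomp Require Import boolp classical_sets functions cardinality.
From mathcomp Require Import interval_inference reals convex.

Set Implicit Arguments.
Unset Strict Implicit.
Unset Printing Implicit Defensive.

Import Order.TTheory GRing.Theory Num.Theory.
Local Open Scope classical_set_scope.
Local Open Scope ring_scope.

Section ConvexHull.
Variables (R : realType) (V : lmodType R).

Definition conv_hull (A : set V) : set V := smallest (@convex_set R V) A.

Definition extreme_points (A : set V) : set V :=
  [set x | A x /\ forall (a b : V) (t : R), A a -> A b -> 0 < t < 1 ->
     x = t *: a + (1 - t) *: b -> a = b].

(* [fset_set] sends infinite sets to the empty set; by
   [finite_extreme_points_hull] below this never happens for a polytope. *)
Definition nb_extreme_points (A : set V) : nat :=
  #|` fset_set (extreme_points A)|%fset.

Lemma sub_conv_hull (A : set V) : A `<=` conv_hull A.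
Proof. exact: sub_gen_smallest. Qed.

Lemma conv_hull_convex (A : set V) : @convex_set R V (conv_hull A).
Proof.
move=> x y t /set_mem xA /set_mem yA; apply/mem_set => B [Bconv AB].
by apply/set_mem/Bconv; apply/mem_set; [apply: xA|apply: yA].
Qed.

Lemma extreme_points_hull_sub (A : set V) :
  extreme_points (conv_hull A) `<=` A.
Proof.
move=> x [xK xext]; apply: contrapT => nAx.
suff : conv_hull A `<=` conv_hull A `\ x by move=> /(_ x xK) [_]; apply.
apply: smallest_sub; last first.
  by move=> y Ay; split; [exact: sub_conv_hull|move=> /= yx; apply: nAx; rewrite -yx].
apply/convex_setW => a b /set_mem[aK ax] /set_mem[bK bx] k k0 k1.
apply/mem_set; split.
  by apply/set_mem/conv_hull_convex; exact/mem_set.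
move=> /= kx.
have ab : a = b by apply: (xext a b k%:num) => //; rewrite ?k0 ?k1.
by apply: ax; rewrite /= -kx ab convmm.
Qed.

Lemma finite_extreme_points_hull (A : set V) :
  finite_set A -> finite_set (extreme_points (conv_hull A)).
Proof. by apply: sub_finite_set; exact: extreme_points_hull_sub. Qed.

End ConvexHull.

(* Main.v *)
Require Import Defs.
From HB Require Import structures.
From mathcomp Require Import all_boot all_order all_algebra finmap.
From mathcomp Require Import boolp classical_sets functions cardinality reals.
From mathcomp Require Import interval_inference convex topology normedtype derive.
From mathcomp Require Import ring lra.

Set Implicit Arguments.
Unset Strict Implicit.
Unset Printing Implicit Defensive.

Import Order.TTheory GRing.Theory Num.Theory.
Local Open Scope classical_set_scope.
Local Open Scope ring_scope.

(** Let [v_1, ..., v_n] be the vertices of [K]; there are at least two of them,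
    and [K] is their hull ([exists_irredundant],
    [nb_extreme_points_irredundant]).

    Sufficiency rests on a colourful Caratheodory theorem with only [d] colours
    and one prescribed point ([colourful_caratheodory]): if [a] lies in the
    hulls of [d] sets and [p] is any point, one point can be picked in each set
    so that [a] lies in the hull of [p] and the picks.  Give each vertex its own
    group of [d] sets.  For the first vertex take the second one as [p]; for all
    other vertices take the first one.  The first two vertices then lie in the
    hull of each other and the picks; as they are distinct, this circular
    dependency resolves, and both lie in the hull of the picks alone
    ([conv_hull_mutual]).  The other vertices follow ([colourful_cover]).

    The colourful theorem is proved by Barany's descent.  With [a] as the origin,
    choose the selection whose hull together with [p] is nearest to the origin.
    If the nearest point [z] is not the origin, then the [d + 1] generators either
    all lie on the hyperplane through [z] orthogonal to it, hence are affinely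
    dependent, or some of them are not needed to express [z]; in both cases one
    generator can be dropped ([min_norm_drop]).  If it is a coloured one,
    exchanging it for a point of its colour on the near side of the hyperplane
    gives a nearer hull.  The obstacle is that the dropped generator may be [p].
    It is removed by replacing [p] by [eps * p]: this does not change whether the
    origin is in the hull, but once [eps * p] is nearer to the origin than the hull
    of every selection, the nearest point cannot be expressed without it.

    For optimality, all the sets are equal to one set of [n * d] points.  Each
    vertex has a hyperplane meeting [K] in that vertex only
    ([supporting_normal]); inside it, surround the vertex by the [d] corners of a
    simplex so small that the corners around the other vertices stay strictly
    on one side ([simplices_around]).  Only the corners around [v_i] can be used to
    express [v_i], and all [d] of them are needed.  So a selection whose hull
    contains [K] uses all [n * d] points. *)

(** * Convex hulls *)

Section Hull.
Variables (R : realType) (V : lmodType R).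
Implicit Types (A B : set V) (x y : V).

Lemma conv_hull_seg A x y (t : R) : 0 <= t -> t <= 1 ->
  conv_hull A x -> conv_hull A y -> conv_hull A (t *: x + (1 - t) *: y).
Proof.
move=> t0 t1 Ax Ay.
have := @conv_hull_convex R V A x y (@Itv01 R t t0 t1) (mem_set Ax) (mem_set Ay).
by move=> /set_mem.
Qed.

Lemma conv_hull_min A (C : set V) : A `<=` C ->
  (forall x y (t : R), 0 <= t -> t <= 1 -> C x -> C y -> C (t *: x + (1 - t) *: y)) ->
  conv_hull A `<=` C.
Proof.
move=> AC Cconv; apply: smallest_sub => // x y t /set_mem Cx /set_mem Cy.
by apply/mem_set; apply: (Cconv x y t%:num).
Qed.

Lemma conv_hull_sub A B : A `<=` conv_hull B -> conv_hull A `<=` conv_hull B.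
Proof. by move=> AB; apply: conv_hull_min => // *; exact: conv_hull_seg. Qed.

Lemma conv_hull_mono A B : A `<=` B -> conv_hull A `<=` conv_hull B.
Proof. by move=> AB; apply: conv_hull_sub => x /AB; exact: sub_conv_hull. Qed.

Lemma conv_hull_seq_sum (I : eqType) (r : seq I) (A : set V) (f : I -> V) (c : I -> R) :
  (forall i, 0 <= c i) -> (forall i, c i != 0 -> A (f i)) ->
  0 < \sum_(i <- r) c i ->
  conv_hull A ((\sum_(i <- r) c i)^-1 *: \sum_(i <- r) c i *: f i).
Proof.
move=> c0 cA; elim: r => [|i r IH]; first by rewrite big_nil ltxx.
rewrite !big_cons; set s := \sum_(j <- r) c j; set u := \sum_(j <- r) _.
have s0 : 0 <= s by rewrite sumr_ge0.
have [ci0|ci0] := eqVneq (c i) 0.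
  by rewrite ci0 scale0r !add0r; exact: IH.
have cip : 0 < c i by rewrite lt_def ci0 c0.
move=> _.
have Afi : conv_hull A (f i) by apply: sub_conv_hull; exact: cA.
have [sz|sn] := eqVneq s 0.
  have -> : u = 0.
    rewrite /u big_seq big1// => j jr.
    move/eqP: sz; rewrite /s psumr_eq0// => /allP/(_ j jr)/= /eqP ->.
    by rewrite scale0r.
  by rewrite sz !addr0 scalerA mulVf// scale1r.
have sp : 0 < s by rewrite lt_def sn s0.
have csn : c i + s != 0 by rewrite gt_eqF// addr_gt0.
have -> : (c i + s)^-1 *: (c i *: f i + u) =
   (c i / (c i + s)) *: f i + (1 - c i / (c i + s)) *: (s^-1 *: u).
  rewrite scalerDr !scalerA mulrC; congr (_ + _ *: _).
  by field; rewrite csn sn.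
apply: conv_hull_seg => //; last exact: IH.
- by rewrite divr_ge0// addr_ge0.
- by rewrite ler_pdivrMr ?addr_gt0// mul1r lerDl.
Qed.

(** The homogeneous form of membership in a hull: weights need a positive sum only,
    not sum 1, so a relation between vectors based at [a] can be rescaled term
    by term. *)
Lemma conv_hull_cone (I : finType) (S : set I) (f : I -> V) (c : I -> R) a :
  (forall i, 0 <= c i) -> (forall i, c i != 0 -> S i) ->
  0 < \sum_i c i -> \sum_i c i *: (f i - a) = 0 ->
  conv_hull (f @` S) a.
Proof.
move=> c0 cS sc.
under eq_bigr do rewrite scalerBr.
rewrite sumrB -scaler_suml => /eqP; rewrite subr_eq0 => /eqP E.
have := @conv_hull_seq_sum I (index_enum I) (f @` S) f c c0 _ sc.
rewrite E scalerA mulVf ?gt_eqF// scale1r; apply => i /cS Si.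
by exists i.
Qed.

Lemma conv_hull_sum (I : finType) (S : set I) (f : I -> V) (c : I -> R) :
  (forall i, 0 <= c i) -> (forall i, c i != 0 -> S i) -> \sum_i c i = 1 ->
  conv_hull (f @` S) (\sum_i c i *: f i).
Proof.
move=> c0 cS c1; apply: (conv_hull_cone c0 cS); first by rewrite c1.
under eq_bigr do rewrite scalerBr.
by rewrite sumrB -scaler_suml c1 scale1r subrr.
Qed.

Lemma conv_hull_comb (I : finType) (S : set I) (f : I -> V) a :
  conv_hull (f @` S) a ->
  exists c : I -> R, [/\ forall i, 0 <= c i, forall i, c i != 0 -> S i,
    \sum_i c i = 1 & \sum_i c i *: f i = a].
Proof.
move: a; apply: conv_hull_min => [_ [i Si <-]|x y t t0 t1].
  exists (fun j => (j == i)%:R); split.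
  - by move=> j; rewrite ler0n.
  - by move=> j; have [->//|] := eqVneq j i; rewrite eqxx.
  - rewrite (bigD1 i)//= eqxx big1 ?addr0// => j /negbTE ->//.
  - rewrite (bigD1 i)//= eqxx scale1r big1 ?addr0// => j /negbTE ->.
    by rewrite scale0r.
move=> [c [c0 cS c1 <-]] [e [e0 eS e1 <-]].
exists (fun i => t * c i + (1 - t) * e i); split.
- by move=> i; rewrite addr_ge0// mulr_ge0// subr_ge0.
- move=> i; have [->|/cS//] := eqVneq (c i) 0.
  by have [->|/eS//] := eqVneq (e i) 0; rewrite !mulr0 addr0 eqxx.
- by rewrite big_split/= -!mulr_sumr c1 e1 !mulr1 addrC subrK.
- rewrite !scaler_sumr -big_split/=; apply: eq_bigr => i _.
  by rewrite scalerDl !scalerA.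
Qed.

(** Makes the selections from arbitrary sets range over a finite type, so that one
    of them can be chosen optimal. *)
Lemma conv_hull_finite A a : conv_hull A a ->
  exists2 s : seq V, [set x | x \in s] `<=` A & conv_hull [set x | x \in s] a.
Proof.
move: a; apply: conv_hull_min => [x Ax|x y t t0 t1 [r rA rx] [s sA sy]].
  exists [:: x] => [y /=|]; first by rewrite inE => /eqP ->.
  by apply: sub_conv_hull; rewrite /= inE.
exists (r ++ s) => [z /=|]; first by rewrite mem_cat => /orP[/rA|/sA].
apply: conv_hull_seg => //.
  by apply: conv_hull_mono rx => z /= zr; rewrite mem_cat zr.
by apply: conv_hull_mono sy => z /= zs; rewrite mem_cat zs orbT.
Qed.

(** The points of this form, together with [p], are a convex set containing [p]
    and [A]. *)
Lemma conv_hull_insert A p a : conv_hull (p |` A) a -> a <> p ->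
  exists (t : R) (c : V), [/\ 0 <= t, t < 1, conv_hull A c & a = t *: p + (1 - t) *: c].
Proof.
pose C := [set x | x = p \/ exists (t : R) (c : V),
  [/\ 0 <= t, t < 1, conv_hull A c & x = t *: p + (1 - t) *: c]].
suff /[apply] : conv_hull (p |` A) `<=` C by case.
apply: conv_hull_min => [x [->|Ax]|].
- by left.
- right; exists 0, x; split => //; first exact: sub_conv_hull.
  by rewrite scale0r add0r subr0 scale1r.
move=> x y s s0 s1 Cx Cy.
have [->|sn0] := eqVneq s 0; first by rewrite scale0r add0r subr0 scale1r.
have [->|sn1] := eqVneq s 1; first by rewrite scale1r subrr scale0r addr0.
have {sn0}s0 : 0 < s by rewrite lt_def sn0.
have {sn1}s1 : 0 < 1 - s by rewrite subr_gt0 lt_neqAle sn1.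
case: Cx => [->|[t [c [t0 t1 Ac ->]]]]; case: Cy => [->|[u [e [u0 u1 Ae ->]]]].
- by left; rewrite -scalerDl addrC subrK scale1r.
- right; exists (s + (1 - s) * u), e; split => //; [nra|nra|].
  rewrite scalerDr !scalerA addrA -scalerDl; congr (_ + _ *: _); ring.
- right; exists (s * t + (1 - s)), c; split => //; [nra|nra|].
  rewrite scalerDr !scalerA addrAC -scalerDl; congr (_ + _ *: _); ring.
(* [w] is the total weight that falls on the hull of [A]. *)
right; set w := s * (1 - t) + (1 - s) * (1 - u).
have w0 : 0 < w by rewrite addr_gt0// mulr_gt0// subr_gt0.
exists (1 - w), ((s * (1 - t) / w) *: c + (1 - s * (1 - t) / w) *: e).
split; [by rewrite /w; nra|by lra| |].
  apply: conv_hull_seg => //.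
  - by rewrite divr_ge0 ?(ltW w0)// mulr_ge0 ?(ltW s0) ?subr_ge0 ?ltW.
  - by rewrite ler_pdivrMr// mul1r /w lerDl mulr_ge0 ?(ltW s1) ?subr_ge0 ?ltW.
have -> : 1 - (1 - w) = w by ring.
rewrite !scalerDr !scalerA addrACA -scalerDl; congr (_ *: _ + (_ *: _ + _ *: _)).
- by rewrite /w; ring.
- by field; rewrite gt_eqF.
- by rewrite [RHS]mulrBr mulr1 [w * (_ / _)]mulrC divfK ?gt_eqF// /w; ring.
Qed.

(** Substituting one expression into the other gives [p] as a combination of [p], with
    coefficient [t * s < 1], and of points of the hull of [A]; solve for [p]. *)
Lemma conv_hull_mutual A p q : p <> q ->
  conv_hull (q |` A) p -> conv_hull (p |` A) q -> conv_hull A p.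
Proof.
move=> pq Ap Aq.
have [t [c [t0 t1 Ac pE]]] := conv_hull_insert Ap pq.
have [s [e [s0 s1 Ae qE]]] := conv_hull_insert Aq (nesym pq).
have ts : 0 < 1 - t * s by nra.
pose w := t * (1 - s) / (1 - t * s).
have w0 : 0 <= w by rewrite divr_ge0 ?(ltW ts)// mulr_ge0// subr_ge0 ltW.
have w1 : w <= 1 by rewrite ler_pdivrMr// mul1r; lra.
suff -> : p = w *: e + (1 - w) *: c by exact: conv_hull_seg.
apply: (scalerI (lt0r_neq0 ts)); rewrite scalerDr !scalerA.
have -> : (1 - t * s) * w = t * (1 - s) by rewrite mulrC divfK ?gt_eqF.
have -> : (1 - t * s) * (1 - w) = 1 - t by rewrite mulrBr mulr1 [_ * w]mulrC divfK ?gt_eqF//; ring.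
rewrite scalerBl scale1r [X in X - _]pE [in X in X - _]qE scalerDr !scalerA.
by rewrite -[X in X - _]addrA addrAC subrr add0r.
Qed.

End Hull.

(** * Points of least norm in a finitely generated hull *)

Section DotProduct.
Variables (R : realType) (d : nat).
Implicit Types u v w : 'rV[R]_d.

Definition dot u v : R := \sum_k u 0 k * v 0 k.

Lemma dotC u v : dot u v = dot v u.
Proof. by apply: eq_bigr => k _; rewrite mulrC. Qed.

Lemma dotDl u v w : dot (u + v) w = dot u w + dot v w.
Proof. by rewrite -big_split/=; apply: eq_bigr => k _; rewrite mxE mulrDl. Qed.

Lemma dotZl (t : R) u v : dot (t *: u) v = t * dot u v.
Proof. by rewrite mulr_sumr; apply: eq_bigr => k _; rewrite mxE mulrA. Qed.

Lemma dotBl u v w : dot (u - v) w = dot u w - dot v w.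
Proof. by rewrite dotDl -scaleN1r dotZl mulN1r. Qed.

Lemma dotDr u v w : dot w (u + v) = dot w u + dot w v.
Proof. by rewrite dotC dotDl !(dotC w). Qed.

Lemma dotZr (t : R) u v : dot u (t *: v) = t * dot u v.
Proof. by rewrite dotC dotZl dotC. Qed.

Lemma dotBr u v w : dot w (u - v) = dot w u - dot w v.
Proof. by rewrite dotC dotBl !(dotC w). Qed.

Lemma dot0l v : dot 0 v = 0.
Proof. by rewrite -(scale0r v) dotZl mul0r. Qed.

Lemma dot_suml (I : finType) (f : I -> 'rV[R]_d) v :
  dot (\sum_i f i) v = \sum_i dot (f i) v.
Proof.
apply: (big_morph (fun u => dot u v)); [by move=> ? ?; exact: dotDl|exact: dot0l].
Qed.

Lemma dot_ge0 u : 0 <= dot u u.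
Proof. by apply: sumr_ge0 => k _; rewrite -expr2 sqr_ge0. Qed.

Lemma dot_eq0 u : (dot u u == 0) = (u == 0).
Proof.
apply/eqP/eqP => [|->]; last exact: dot0l.
move=> /eqP; rewrite psumr_eq0 => [/allP u0|k _]; last by rewrite -expr2 sqr_ge0.
apply/rowP => k; rewrite mxE; apply/eqP.
by have := u0 k (mem_index_enum k); rewrite /= mulf_eq0 orbb.
Qed.

Lemma dot_gt0 u : (0 < dot u u) = (u != 0).
Proof. by rewrite lt_def dot_eq0 dot_ge0 andbT. Qed.

End DotProduct.

Section MinNorm.
Import numFieldNormedType.Exports.
Variables (R : realType) (d : nat).
Implicit Types (A : set 'rV[R]_d).

Lemma continuous_sum (T : topologicalType) (I : finType) (f : I -> T -> R) :
  (forall i, continuous (f i)) -> continuous (fun x => \sum_i f i x).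
Proof.
move=> fc x; apply: cvg_big => [|i _]; [exact: add_continuous|exact: fc].
Qed.

Lemma simplex_compact k :
  compact [set w : 'rV[R]_k | (forall j, 0 <= w 0 j <= 1) /\ \sum_j w 0 j = 1].
Proof.
rewrite (_ : [set _ | _] = [set w : 'rV[R]_k | forall j, `[0%R, 1%R]%classic (w 0 j)] `&`
    (fun w : 'rV[R]_k => \sum_j w 0 j) @^-1` [set x | x = 1]).
  apply: compact_closedI.
    by apply: (@rV_compact R k (fun=> `[0%R, 1%R]%classic)) => i; exact: segment_compact.
  apply: preimage_closed; last exact: closed_eq.
  by move=> w _; apply: continuous_sum => i; exact: coord_continuous.
by apply/seteqP; split => w /= [w01 ?]; split => // j; have := w01 j; rewrite /= in_itv.
Qed.

Lemma exists_min_norm_ord k (g : 'I_k.+1 -> 'rV[R]_d) :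
  exists2 z, conv_hull (range g) z &
    forall y, conv_hull (range g) y -> dot z z <= dot y y.
Proof.
pose D := [set w : 'rV[R]_k.+1 | (forall j, 0 <= w 0 j <= 1) /\ \sum_j w 0 j = 1].
pose G (w : 'rV[R]_k.+1) := \sum_j w 0 j *: g j.
have Gc : continuous (fun w => dot (G w) (G w)).
  apply: continuous_sum => l.
  have cl : continuous (fun w => G w 0 l).
    have -> : (fun w => G w 0 l) = (fun w : 'rV[R]_k.+1 => \sum_j (w 0 j * g j 0 l)).
      by apply/funext => w; rewrite summxE; apply: eq_bigr => j _; rewrite mxE.
    apply: continuous_sum => j w.
    apply: (@continuousM R _ (fun w : 'rV[R]_k.+1 => w 0 j) (fun=> g j 0 l));
      last exact: cst_continuous.
    exact: coord_continuous.
  by move=> w; apply: continuousM; exact: cl.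
have [||//|w /set_mem [w01 w1] wmin] := @EVT_min_rV R k.+1 (fun w => dot (G w) (G w)) D.
- exists (delta_mx 0 ord0); split => [j|].
    by rewrite mxE eqxx/= ler0n lern1 leq_b1.
  rewrite (bigD1 ord0)//= mxE !eqxx big1 ?addr0// => j /negbTE jn0.
  by rewrite mxE jn0 andbF.
- exact: simplex_compact.
- exact: continuous_subspaceT.
exists (G w).
  by apply: conv_hull_sum => // j; case/andP: (w01 j).
move=> y /conv_hull_comb [c [c0 _ c1 <-]].
have -> : \sum_i c i *: g i = G (\row_j c j) by apply: eq_bigr => j _; rewrite mxE.
apply: wmin; apply/mem_set; split => [j|]; last by under eq_bigr do rewrite mxE.
by rewrite mxE c0/= -c1 (bigD1 j)//= lerDl sumr_ge0.
Qed.

Lemma exists_min_norm (I : finType) (i0 : I) (g : I -> 'rV[R]_d) :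
  exists2 z, conv_hull (range g) z &
    forall y, conv_hull (range g) y -> dot z z <= dot y y.
Proof.
have : (0 < #|I|)%N by apply/card_gt0P; exists i0.
case E : #|I| => [//|k] _.
have [z zg zmin] := @exists_min_norm_ord k (g \o enum_val \o cast_ord (esym E)).
suff <- : range (g \o enum_val \o cast_ord (esym E)) = range g by exists z.
apply/seteqP; split => _ [j _ <-]; first by eexists.
by exists (cast_ord E (enum_rank j)) => //=; rewrite cast_ordK enum_rankK.
Qed.

(** The hull lies beyond the hyperplane through [z] orthogonal to [z]: a point [y]
    strictly before it would make [z] move to a point of smaller norm on the
    segment towards [y]. *)
Lemma min_norm_dot A z : conv_hull A z ->
  (forall y, conv_hull A y -> dot z z <= dot y y) ->
  forall y, conv_hull A y -> dot z z <= dot y z.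
Proof.
move=> Az zmin y Ay; rewrite leNgt; apply/negP => yz.
have [u uE] : exists u, u = y - z by exists (y - z).
have b0 : 0 < - dot u z by rewrite uE dotBl opprB subr_gt0.
have a0 := dot_ge0 u.
set b := - dot u z in b0; set a := dot u u in a0.
(* Along [z + t *: u] the squared norm changes by [- 2 * t * b + t ^+ 2 * a],
   which is negative for this [t] because [t * a < b]. *)
pose t := b / (b + a).
have ba : 0 < b + a by rewrite ltr_wpDr.
have t0 : 0 < t by rewrite divr_gt0.
have ta : t * a < b.
  by rewrite mulrAC ltr_pdivrMr// ltr_pM2l// ltrDr.
have t1 : t <= 1 by rewrite ler_pdivrMr// mul1r lerDl.
have := zmin _ (conv_hull_seg (ltW t0) t1 Ay Az).
have -> : t *: y + (1 - t) *: z = z + t *: u.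
  by rewrite uE scalerBr scalerBl scale1r addrCA.
rewrite !(dotDl, dotDr, dotZl, dotZr) (dotC z u) -/a.
have -> : dot u z = - b by rewrite opprK.
apply/negP; rewrite -ltNge; nra.
Qed.

Lemma lin_dep (I : finType) (g : I -> 'rV[R]_d) : (d < #|I|)%N ->
  exists e : I -> R, (exists i, e i != 0) /\ \sum_i e i *: g i = 0.
Proof.
move=> dI.
pose M := \matrix_(j < #|I|) g (enum_val j).
have : kermx M != 0.
  rewrite kermx_eq0 /row_free; apply/negP => /eqP rM.
  by have := rank_leq_col M; rewrite rM leqNgt dI.
case/rowV0Pn => v /sub_kermxP vM v0.
exists (fun i => v 0 (enum_rank i)); split.
  case/rV0Pn: v0 => j vj; exists (enum_val j); by rewrite enum_valK.
rewrite (reindex (@enum_val I predT)); last exact/onW_bij/enum_val_bij.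
apply: etrans vM; rewrite mulmx_sum_row; apply: eq_bigr => j _.
by rewrite enum_valK rowK.
Qed.

(** Move from [c] in the direction [e] until the first weight vanishes. *)
Lemma drop_weight (I : finType) (c e : I -> R) :
  (forall i, 0 <= c i) -> (exists i, e i != 0) -> \sum_i e i = 0 ->
  exists t, (forall i, 0 <= c i + t * e i) /\ exists i, c i + t * e i = 0.
Proof.
move=> c0 [i ei] e0.
have [i1 ei1] : exists i, e i < 0.
  apply: contrapT => noneg; move/eqP: ei; apply; apply/eqP.
  have ege0 j : 0 <= e j by rewrite leNgt; apply/negP => ej; apply: noneg; exists j.
  move/eqP: e0; rewrite psumr_eq0// => /allP/(_ i)/=; apply.
  by rewrite mem_index_enum.
case: (@arg_minP _ _ _ i1 (fun i => e i < 0) (fun i => c i / - e i) ei1) => j ej jmin.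
have jp : 0 < - e j by rewrite oppr_gt0.
exists (c j / - e j); split => [l|]; last first.
  by exists j; rewrite invrN mulrN mulNr divfK ?subrr// lt_eqF.
have [el|el] := leP 0 (e l).
  by rewrite addr_ge0// mulr_ge0// divr_ge0// ltW.
have lp : 0 < - e l by rewrite oppr_gt0.
by have := jmin l el; rewrite ler_pdivlMr// mulrN -subr_ge0 opprK.
Qed.

(** Caratheodory's theorem with one generator fewer than usual.  If no weight of
    [z] vanishes, all generators satisfy [dot (g i) z = dot z z], so every linear
    relation between them has coefficients of sum zero: [d + 1] generators,
    rather than [d + 2], suffice to cancel a weight. *)
Lemma min_norm_drop (I : finType) (g : I -> 'rV[R]_d) z : (d < #|I|)%N ->
  conv_hull (range g) z ->
  (forall y, conv_hull (range g) y -> dot z z <= dot y y) -> z != 0 ->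
  exists i, conv_hull (g @` [set j | j != i]) z.
Proof.
move=> dI zg zmin z0.
have gz i : dot z z <= dot (g i) z.
  by apply: (min_norm_dot zg zmin); apply: sub_conv_hull; exists i.
have [c [c0 _ c1 cz]] := conv_hull_comb zg.
suff [e [e0 e1 ez [i ei]]] : exists e : I -> R, [/\ forall i, 0 <= e i, \sum_i e i = 1,
    \sum_i e i *: g i = z & exists i, e i = 0].
  exists i; rewrite -ez; apply: conv_hull_sum => // j.
  by apply: contra_neq => ->.
have [/existsP[i /eqP ci]|/existsPn cn0] := boolP [exists i, c i == 0].
  by exists c; split => //; exists i.
have gzE i : dot (g i) z = dot z z.
  apply/eqP; rewrite -subr_eq0.
  have : \sum_i c i * (dot (g i) z - dot z z) == 0.
    under eq_bigr do rewrite mulrBr -dotZl.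
    by rewrite sumrB -dot_suml cz -mulr_suml c1 mul1r subrr.
  rewrite psumr_eq0 => [/allP/(_ i)|j _]; last by rewrite mulr_ge0// subr_ge0.
  by rewrite mem_index_enum /= mulf_eq0 (negbTE (cn0 i)) => /(_ isT).
have [e [en0 e0]] := lin_dep g dI.
have se : \sum_i e i = 0.
  have : dot (\sum_i e i *: g i) z = 0 by rewrite e0 dot0l.
  rewrite dot_suml; under eq_bigr do rewrite dotZl gzE.
  by rewrite -mulr_suml => /eqP; rewrite mulf_eq0 dot_eq0 (negbTE z0) orbF => /eqP.
have [t [t0 [i ti]]] := drop_weight c0 en0 se.
exists (fun i => c i + t * e i); split => //; last by exists i.
- by rewrite big_split/= -mulr_sumr se mulr0 addr0.
- under eq_bigr do rewrite scalerDl -scalerA.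
  by rewrite big_split/= -scaler_sumr e0 scaler0 addr0.
Qed.

End MinNorm.

(** * A colourful Caratheodory theorem with d colours and a prescribed point *)

Section Colourful.
Variables (R : realType) (d : nat).

Lemma pos_lower_bound (I : finType) (a : I -> R) : (forall i, 0 < a i) ->
  exists2 e, 0 < e & forall i, e <= a i.
Proof.
move=> a0.
have s0 : 0 <= \sum_i (a i)^-1 by apply: sumr_ge0 => i _; rewrite invr_ge0 ltW.
exists (1 + \sum_i (a i)^-1)^-1; first by rewrite invr_gt0 ltr_pwDl.
move=> i; rewrite -[leRHS]invrK lef_pV2 ?posrE ?invr_gt0 ?ltr_pwDl//.
rewrite (bigD1 i)//= addrCA lerDl addr_ge0// sumr_ge0// => j _.
by rewrite invr_ge0 ltW.
Qed.

Lemma conv_hull_dot_le (A : set 'rV[R]_d) a z : conv_hull A a ->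
  exists2 y, A y & dot y z <= dot a z.
Proof.
move=> Aa; apply: contrapT => nA.
suff : conv_hull A `<=` [set y | dot a z < dot y z] by move=> /(_ a Aa); rewrite /= ltxx.
apply: conv_hull_min => [y Ay /=|x y t t0 t1 /= xz yz].
  by rewrite ltNge; apply/negP => yz; apply: nA; exists y.
rewrite dotDl !dotZl; have [->|tn0] := eqVneq t 0; first by lra.
have {tn0}t0 : 0 < t by rewrite lt_def tn0.
nra.
Qed.

(** The norm bound of Cauchy and Schwarz, read off from the square of [u - z]. *)
Lemma dot_ge_norm_le (u z : 'rV[R]_d) : dot z z <= dot u z -> dot z z <= dot u u.
Proof.
have := dot_ge0 (u - z); rewrite !(dotBl, dotBr) (dotC z u); lra.
Qed.

(** Suppose no selection works.  Then every selection has a positive distance to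
    [a], and [p] can be pulled towards [a] until it is nearer than all of them.
    Among the hulls of the pulled point and a selection, the one nearest to [a]
    can be brought still nearer by changing one colour. *)
Lemma colourful_caratheodory (a p : 'rV[R]_d) (X : 'I_d -> set 'rV[R]_d) :
  (0 < d)%N -> (forall i, conv_hull (X i) a) ->
  exists x : 'I_d -> 'rV[R]_d,
    (forall i, X i (x i)) /\ conv_hull (p |` range x) a.
Proof.
move=> d0 Xa.
have /choice[s sP] : forall i, exists s : seq 'rV[R]_d,
    [set x | x \in s] `<=` X i /\ conv_hull [set x | x \in s] a.
  by move=> i; have [s ? ?] := conv_hull_finite (Xa i); exists s.
have sX i x : x \in s i -> X i x by case: (sP i) => + _; apply.
have sa i : conv_hull [set x | x \in s i] a by case: (sP i).
pose T : finType := {dffun forall i, seq_sub (s i)}.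
pose pt (t : T) i : 'rV[R]_d := ssval (t i).
have ptX t i : X i (pt t i) by apply: sX; exact: ssvalP.
apply: contrapT => nx.
have nconv t : ~ conv_hull (p |` range (pt t)) a by move=> ta; apply: nx; exists (pt t).
have t0 : T.
  have ne i : {x | x \in s i}.
    by apply: cid; have [y] := conv_hull_dot_le 0 (sa i); exists y.
  exact: (finfun (fun i => SeqSub (svalP (ne i)))).
pose h t i := pt t i - a.
(* A convex combination of the pulled point and the selection that equals [a]
   becomes one of [p] and the selection when the weight of [p] is multiplied by
   [e] and the weights are normalised. *)
have hull0 t (e : R) (g : option 'I_d -> 'rV[R]_d) : 0 < e ->
    g None = e *: (p - a) -> (forall i, g (Some i) = h t i) ->
    ~ conv_hull (range g) 0.
  move=> e0 gN gS /conv_hull_comb[c [c0 _ c1 cg]]; apply: (nconv t).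
  pose f (o : option 'I_d) := oapp (pt t) p o.
  have <- : range f = p |` range (pt t).
    apply/seteqP; split => [_ [[i|] _ <-]|_ [->|[i _ <-]]].
    - by right; exists i.
    - by left.
    - by exists None.
    - by exists (Some i).
  pose k (o : option 'I_d) : R := oapp (fun=> 1) e o.
  have k0 o : 0 < k o by case: o.
  have ck0 o : 0 <= c o * k o by rewrite mulr_ge0// ltW.
  apply: (@conv_hull_cone _ _ _ _ _ (fun o => c o * k o)) => //.
    rewrite lt_def sumr_ge0// andbT; apply/eqP => /eqP.
    rewrite psumr_eq0// => /allP ck.
    suff : \sum_o c o = 0 by rewrite c1 => /eqP; rewrite oner_eq0.
    rewrite big1// => o _; have := ck o (mem_index_enum o).
    by rewrite /= mulf_eq0 (gt_eqF (k0 o)) orbF => /eqP.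
  rewrite -[RHS]cg; apply: eq_bigr => -[i|] _ /=; first by rewrite mulr1 gS.
  by rewrite -scalerA gN.
have /choice[m mP] : forall t : T, exists m : 'rV[R]_d, [/\ 0 < dot m m &
    forall y, conv_hull (range (h t)) y -> dot m m <= dot y y].
  move=> t; have [m hm mmin] := exists_min_norm (Ordinal d0) (h t).
  exists m; split => //; rewrite dot_gt0; apply/eqP => m0.
  apply: (@hull0 t 1 (oapp (h t) (1 *: (p - a)))) => //.
  rewrite -m0; apply: conv_hull_mono hm => _ [i _ <-]; by exists (Some i).
have [D D0 Dm] : exists2 D, 0 < D & forall t, D <= dot (m t) (m t).
  by apply: pos_lower_bound => t; case: (mP t).
have [e e0 eD] : exists2 e, 0 < e & dot (e *: (p - a)) (e *: (p - a)) < D.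
  have P0 := dot_ge0 (p - a); set P := dot _ _ in P0.
  have q0 : 0 < 1 + D + P by lra.
  have e1 : D / (1 + D + P) <= 1 by rewrite ler_pdivrMr//; lra.
  have e2 : D / (1 + D + P) * P < D.
    rewrite mulrAC ltr_pdivrMr// ltr_pM2l//; lra.
  have e0 : 0 < D / (1 + D + P) by rewrite divr_gt0.
  exists (D / (1 + D + P)) => //.
  rewrite dotZl dotZr -/P; apply: le_lt_trans e2.
  by rewrite ler_piMl// mulr_ge0// ltW.
pose g t (o : option 'I_d) := oapp (h t) (e *: (p - a)) o.
have /choice[z zP] : forall t : T, exists z : 'rV[R]_d, conv_hull (range (g t)) z /\
    forall y, conv_hull (range (g t)) y -> dot z z <= dot y y.
  by move=> t; have [z ? ?] := exists_min_norm None (g t); exists z.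
case: (@arg_minP _ _ _ t0 xpredT (fun t => dot (z t) (z t)) isT) => t _ tmin.
have [zt ztmin] := zP t.
have z0 : z t != 0 by apply/eqP => z0; apply: (@hull0 t e (g t)) => //; rewrite -z0.
have dI : (d < #|{: option 'I_d}|)%N by rewrite card_option card_ord.
(* Without the pulled point, [z t] would lie in the hull of the selection alone,
   hence at squared distance at least [D]; but it is at least as near as the
   pulled point. *)
have [[i|] zi] := min_norm_drop dI zt ztmin z0; last first.
  have : dot (z t) (z t) < D.
    apply: le_lt_trans eD; apply: dot_ge_norm_le.
    apply: (min_norm_dot zt ztmin); apply: sub_conv_hull; by exists None.
  apply/negP; rewrite -leNgt (le_trans (Dm t))//.
  have [_] := mP t; apply; apply: conv_hull_mono zi => _ [[j|//] _ <-].
  by exists j.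
(* Colour [i] is free: its hull contains [a], so it has a point [y] that is not
   beyond the hyperplane through [a] orthogonal to [z t]. *)
have [y ys yz] := conv_hull_dot_le (z t) (sa i).
pose t' : T := finfun (dfwith t (SeqSub ys)).
have t'i : pt t' i = y by rewrite /pt ffunE dfwith_in.
have t'j j : j != i -> pt t' j = pt t j by move=> ji; rewrite /pt ffunE dfwith_out// eq_sym.
have zt' : conv_hull (range (g t')) (z t).
  apply: conv_hull_mono zi => _ [o /= oi <-]; exists o => //.
  by case: o oi => //= j ji; rewrite /h t'j.
have : dot (z t) (z t) <= dot (y - a) (z t).
  apply: (min_norm_dot zt').
    by move=> u /(proj2 (zP t')); apply: le_trans; exact: tmin.
  apply: sub_conv_hull; exists (Some i) => //=; by rewrite /h t'i.
apply/negP; rewrite -ltNge dotBl.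
by rewrite (@le_lt_trans _ _ 0)// ?subr_le0// dot_gt0.
Qed.

End Colourful.

(** * Vertices of a polytope *)

Section Irredundant.
Variables (R : realType) (V : lmodType R).

Definition irredundant (I : Type) (v : I -> V) :=
  forall i, ~ conv_hull (v @` [set j | j <> i]) (v i).

(** Take a subfamily with the same hull and the fewest members. *)
Lemma exists_irredundant (I : finType) (p : I -> V) : exists n (v : 'I_n -> V),
  irredundant v /\ conv_hull (range v) = conv_hull (range p).
Proof.
pose P (S : {set I}) := `[< range p `<=` conv_hull (p @` [set i | i \in S]) >].
have PT : P [set: I]%SET.
  by apply/asboolP => _ [i _ <-]; apply: sub_conv_hull; exists i => //=; rewrite in_setT.
case: (@arg_minnP _ _ P (fun S => #|S|) PT) => S /asboolP pS Smin.
exists #|S|, (p \o enum_val); split; last first.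
  apply/seteqP; split.
    by apply: conv_hull_mono => _ [i _ <-]; exists (enum_val i).
  apply: conv_hull_sub => _ [i _ <-]; have := pS (p i) (imageT p i).
  apply: conv_hull_mono => _ [j /= jS <-].
  by exists (enum_rank_in jS j) => //=; rewrite enum_rankK_in.
move=> i pi; have iS := enum_valP i.
suff /Smin : P (S :\ enum_val i)%SET by rewrite (cardsD1 (enum_val i) S) iS add1n ltnn.
have sub j : j \in S -> j != enum_val i ->
    conv_hull (p @` [set i0 | i0 \in (S :\ enum_val i)%SET]) (p j).
  by move=> jS ji; apply: sub_conv_hull; exists j => //=; rewrite !inE ji.
apply/asboolP => x /pS; apply: conv_hull_sub => _ [j /= jS <-].
have [->|/(sub j jS)//] := eqVneq j (enum_val i).
apply: conv_hull_sub pi => _ [k /= ki <-]; apply: sub; first exact: enum_valP.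
by apply: contra_not_neq ki => /enum_val_inj.
Qed.

Lemma irredundant_inj (I : Type) (v : I -> V) : irredundant v -> injective v.
Proof.
move=> virr i j vij; apply: contrapT => ij; apply: (virr i).
by apply: sub_conv_hull; exists j => //= ji; apply: ij.
Qed.

Lemma convex_weight1 (I : finType) (v : I -> V) (c : I -> R) i :
  (forall j, 0 <= c j) -> \sum_j c j = 1 -> c i = 1 -> \sum_j c j *: v j = v i.
Proof.
move=> c0 + ci; rewrite (bigD1 i)//= ci => /(canRL (addKr _)); rewrite addNr => /eqP.
rewrite psumr_eq0// => /allP cj.
rewrite (bigD1 i)//= ci scale1r big1 ?addr0// => j ji.
by have := cj j (mem_index_enum j); rewrite ji /= => /eqP ->; rewrite scale0r.
Qed.

(** If [v i] is strictly between two points of the hull, it is a convex combination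
    of the generators with weights [c].  Unless [c i = 1], cancelling the term of
    index [i] expresses [v i] by the other generators; and [c i = 1] forces both
    points to be [v i]. *)
Lemma extreme_points_irredundant (I : finType) (v : I -> V) : irredundant v ->
  extreme_points (conv_hull (range v)) = range v.
Proof.
move=> virr; apply/seteqP; split; first exact: extreme_points_hull_sub.
move=> _ [i _ <-]; split; first by apply: sub_conv_hull; exists i.
move=> _ _ t /conv_hull_comb[a [a0 _ a1 <-]] /conv_hull_comb[b [b0 _ b1 <-]].
move=> /andP[t0 t1] vE.
pose c j := t * a j + (1 - t) * b j.
have t1' : 0 < 1 - t by rewrite subr_gt0.
have c0 j : 0 <= c j by rewrite addr_ge0// mulr_ge0// ltW.
have c1 : \sum_j c j = 1.
  by rewrite big_split/= -!mulr_sumr a1 b1 !mulr1 addrC subrK.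
have cv : \sum_j c j *: (v j - v i) = 0.
  under eq_bigr do rewrite scalerBr.
  rewrite sumrB -scaler_suml c1 scale1r [X in _ - X]vE !scaler_sumr -big_split/=.
  by rewrite -sumrB big1// => j _; rewrite !scalerA -scalerDl subrr.
have le1 (e : I -> R) : (forall j, 0 <= e j) -> \sum_j e j = 1 -> e i <= 1.
  by move=> e0 <-; rewrite (bigD1 i)//= lerDl sumr_ge0.
have ci1 : c i = 1.
  apply: contrapT => ci; apply: (virr i).
  apply: (@conv_hull_cone _ _ _ _ _ (fun j => if j == i then 0 else c j)).
  - by move=> j; case: eqP.
  - by move=> j; case: (eqVneq j i) => [->|/eqP//]; rewrite eqxx.
  - have ci_lt1 : c i < 1 by rewrite lt_neqAle le1// andbT; exact/eqP.
    rewrite (bigD1 i)//= eqxx add0r.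
    rewrite (eq_bigr c) => [|j /negbTE ->//].
    by move: c1 ci_lt1; rewrite (bigD1 i)//=; lra.
  - rewrite -[RHS]cv; apply: eq_bigr => j _; case: eqP => // ->.
    by rewrite subrr !scaler0.
have ai := le1 a a0 a1; have bi := le1 b b0 b1.
have ai1 : a i = 1 by move: ci1; rewrite /c; nra.
have bi1 : b i = 1 by move: ci1; rewrite /c; nra.
by rewrite !(@convex_weight1 _ _ _ i).
Qed.

Lemma nb_extreme_points_irredundant n (v : 'I_n -> V) : irredundant v ->
  nb_extreme_points (conv_hull (range v)) = n.
Proof.
move=> virr; rewrite /nb_extreme_points extreme_points_irredundant//.
rewrite -[RHS](card_ord n) -(size_codom v) -[LHS]/(size _).
apply/perm_size/uniq_perm; first exact: fset_uniq.
  by rewrite map_inj_uniq ?enum_uniq//; exact: irredundant_inj.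
move=> x; rewrite in_fset_set; last exact: finite_image.
by apply/idP/codomP => [/set_mem[i _ <-]|[i ->]]; [exists i|apply/mem_set; exists i].
Qed.

Lemma conv_hull_range_le1 n (v : 'I_n -> V) : (n <= 1)%N ->
  forall x y, conv_hull (range v) x -> conv_hull (range v) y -> x = y.
Proof.
move=> n1.
have vE i j : v i = v j.
  congr v; apply/val_inj => /=.
  by have := ltn_ord i; have := ltn_ord j; case: n n1 {v} i j => [|[]]// _ [[]]// ? [[]].
have hv : conv_hull (range v) `<=` range v.
  apply: conv_hull_min => // _ _ t _ _ [i _ <-] [j _ <-]; exists i => //.
  by rewrite (vE j i) -scalerDl addrC subrK scale1r.
by move=> x y /hv[i _ <-] /hv[j _ <-]; exact: vE.
Qed.

End Irredundant.

(** * Covering a polytope by coloured points *)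

Section Upper.
Variables (R : realType).

Lemma colourful_cover (d n : nat) (v : 'I_n -> 'rV[R]_d)
    (X : 'I_n -> 'I_d -> set 'rV[R]_d) :
  (0 < d)%N -> (2 <= n)%N -> injective v ->
  (forall i k j, conv_hull (X i k) (v j)) ->
  exists x : 'I_n -> 'I_d -> 'rV[R]_d, (forall i k, X i k (x i k)) /\
    forall j, conv_hull [set x i k | i in setT & k in setT] (v j).
Proof.
move=> d0 n2 vinj Xv.
pose i0 : 'I_n := Ordinal (ltnW n2); pose i1 : 'I_n := Ordinal n2.
(* The prescribed point for vertex [j]; it is always another vertex. *)
pose pivot j := if j == i0 then i1 else i0.
have /choice[x xP] : forall j, exists x : 'I_d -> 'rV[R]_d,
    (forall k, X j k (x k)) /\ conv_hull (v (pivot j) |` range x) (v j).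
  by move=> j; apply: colourful_caratheodory.
exists x; split; first by move=> i; case: (xP i).
set C := [set _ | _ in _ & _ in _].
have vC j : conv_hull (v (pivot j) |` C) (v j).
  have [_] := xP j; apply: conv_hull_mono => y [->|[k _ <-]]; first by left.
  by right; exists j => //; exists k.
have v0 : conv_hull C (v i0).
  apply: (@conv_hull_mutual _ _ _ _ (v i1)); [by move/vinj|exact: (vC i0)|exact: (vC i1)].
move=> j; have [->//|ji] := eqVneq j i0.
have := vC j; rewrite /pivot (negbTE ji); apply: conv_hull_sub => y [->//|].
exact: sub_conv_hull.
Qed.

End Upper.

(** * Small simplices around the vertices *)

Section Lower.
Variables (R : realType) (d : nat).

(** The point of least norm in the hull of the [v j - v i] is such a normal; it is
    nonzero because the family is irredundant. *)
Lemma supporting_normal n (v : 'I_n -> 'rV[R]_d) i : (2 <= n)%N -> irredundant v ->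
  exists w, w != 0 /\ forall j, j != i -> 0 < dot (v j - v i) w.
Proof.
move=> n2 virr.
have [j0 j0i] : exists j, j != i.
  pose i0 : 'I_n := Ordinal (ltnW n2); pose i1 : 'I_n := Ordinal n2.
  by have [<-|] := eqVneq i0 i; [exists i1|exists i0].
pose g (j : {j | j != i}) := v (val j) - v i.
have [z zg zmin] := exists_min_norm (exist (fun j => j != i) j0 j0i : {j | j != i}) g.
have z0 : z != 0.
  apply/eqP => z0; move: zg; rewrite z0 => /conv_hull_comb[c [c0 _ c1 cg]].
  apply: (virr i); apply: (@conv_hull_mono _ _ (range (fun j : {j | j != i} => v (val j)))).
    by move=> _ [[j ji] _ <-]; exists j => //=; exact/eqP.
  by apply: (@conv_hull_cone _ _ _ _ _ c) => //; rewrite c1.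
exists z; split => // j ji; rewrite -dot_gt0 in z0; apply: (lt_le_trans z0).
apply: (min_norm_dot zg zmin); apply: sub_conv_hull.
by exists (exist (fun j => j != i) j ji : {j | j != i}).
Qed.

(** The corners of a [d.-1]-dimensional simplex with barycentre [0] in the hyperplane
    orthogonal to [w]: a basis [b] of the whole space on the affine hyperplane
    [dot x w = 1], translated by its mean [m].  Since [b] is free, [0] is the
    combination of the corners with sum 1 only when all weights are [1 / d]. *)
Lemma simplex_directions (w : 'rV[R]_d) : w != 0 ->
  exists e : 'I_d -> 'rV[R]_d, [/\ forall k, dot (e k) w = 0, \sum_k e k = 0 &
    forall c : 'I_d -> R, \sum_k c k = 1 -> \sum_k c k *: e k = 0 -> forall k, c k != 0].
Proof.
move=> /rV0Pn[k0 wk0].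
have d0 : d%:R != 0 :> R by rewrite pnatr_eq0 -lt0n (leq_ltn_trans _ (ltn_ord k0)).
pose b k : 'rV[R]_d := delta_mx 0 k + ((1 - w 0 k) / w 0 k0) *: delta_mx 0 k0.
have dot_delta k : dot (delta_mx 0 k) w = w 0 k.
  rewrite /dot (bigD1 k)//= mxE !eqxx mul1r big1 ?addr0// => j /negbTE jk.
  by rewrite mxE jk andbF mul0r.
have bw k : dot (b k) w = 1 by rewrite dotDl dotZl !dot_delta divfK// addrC subrK.
pose m := d%:R^-1 *: \sum_k b k.
have sum_inv : \sum_(k < d) d%:R^-1 = 1 :> R.
  by rewrite sumr_const card_ord -[LHS]mulr_natr mulVf.
exists (fun k => b k - m); split.
- move=> k; rewrite dotBl bw /m dotZl dot_suml (eq_bigr (fun=> 1)) => [|l _]; last exact: bw.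
  by rewrite sumr_const card_ord mulVf ?subrr.
- by rewrite sumrB sumr_const card_ord -[m *+ _]scaler_nat /m scalerA mulfV// scale1r subrr.
move=> c c1 cb.
pose c' k := c k - d%:R^-1.
have c'0 : \sum_k c' k = 0 by rewrite sumrB c1 sum_inv subrr.
have c'b : \sum_k c' k *: b k = 0.
  rewrite -[RHS]cb; under eq_bigr do rewrite scalerBl.
  under [RHS]eq_bigr do rewrite scalerBr.
  by rewrite !sumrB -scaler_suml c1 scale1r -scaler_sumr.
have c'k j : j != k0 -> c' j = 0.
  move=> jk; move/rowP: c'b => /(_ j); rewrite summxE (bigD1 j)//= big1 => [|l /negbTE lj].
    by rewrite !mxE !eqxx (negbTE jk) andbF mulr0 !addr0 mulr1.
  by rewrite !mxE (negbTE jk) eq_sym lj !andbF mulr0 addr0 mulr0.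
have c'k0 : c' k0 = 0.
  by rewrite -[RHS]c'0 (bigD1 k0)//= big1 ?addr0.
move=> k; have : c' k = 0 by have [->//|/c'k] := eqVneq k k0.
by move/eqP; rewrite subr_eq0 => /eqP ->; rewrite invr_eq0.
Qed.

Lemma sum_pair_fst (M : nmodType) (I J : finType) (F : I * J -> M) i :
  (forall q, q.1 != i -> F q = 0) -> \sum_q F q = \sum_k F (i, k).
Proof.
move=> F0; rewrite (eq_bigr (fun q => F (q.1, q.2))) => [|[]//].
rewrite -(pair_bigA _ (fun j k => F (j, k)))/= (bigD1 i)//= [X in _ + X]big1 ?addr0// => j ji.
by rewrite big1// => k _; exact: F0.
Qed.

(** The functional [dot (_ - v i) (w i)] vanishes at the corners around [v i] and is
    positive at all others, so only the former can carry weight in a convex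
    combination equal to [v i]; and all of those do. *)
Lemma simplices_around n (v : 'I_n -> 'rV[R]_d) : (0 < d)%N -> (2 <= n)%N -> irredundant v ->
  exists u : 'I_n * 'I_d -> 'rV[R]_d, (forall i, conv_hull (range u) (v i)) /\
    forall S : set ('I_n * 'I_d), (forall i, conv_hull (u @` S) (v i)) -> S = setT.
Proof.
move=> d0 n2 virr.
have /choice[w wP] := fun i => supporting_normal i n2 virr.
have /choice[e eP] : forall i, exists e : 'I_d -> 'rV[R]_d,
    [/\ forall k, dot (e k) (w i) = 0, \sum_k e k = 0 &
    forall c : 'I_d -> R, \sum_k c k = 1 -> \sum_k c k *: e k = 0 -> forall k, c k != 0].
  by move=> i; apply: simplex_directions; case: (wP i).
have [D D0 Dw] : exists2 D, 0 < D & forall i j k, j != i ->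
    0 < dot (v j - v i + D *: e j k) (w i).
  (* [D] is a common lower bound of these ratios, so that [D] times the absolute
     value of the second dot product stays below the first; on the diagonal any
     positive value will do. *)
  pose a (q : 'I_n * 'I_n * 'I_d) := if q.1.2 == q.1.1 then 1 else
     dot (v q.1.2 - v q.1.1) (w q.1.1) / (1 + `|dot (e q.1.2 q.2) (w q.1.1)|).
  have [q|D D0 Da] := @pos_lower_bound R _ a.
    rewrite /a; case: eqVneq => // ji; rewrite divr_gt0 ?ltr_pwDl//.
    by case: (wP q.1.1) => _; apply.
  exists D => // i j k ji; have := Da (i, j, k); rewrite /a /= (negbTE ji).
  rewrite ler_pdivlMr ?ltr_pwDl// (dotDl (v j - v i)) dotZl.
  set x := dot (e j k) _ => Dx.
  have : - `|x| <= x by rewrite lerNl -(normrN x) ler_norm.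
  nra.
pose u (q : 'I_n * 'I_d) := v q.1 + D *: e q.1 q.2.
exists u; split => [i|S Sv].
  apply: (@conv_hull_mono _ _ (range (fun k => u (i, k)))).
    by move=> _ [k _ <-]; exists (i, k).
  apply: (@conv_hull_cone _ _ _ _ _ (fun=> 1)) => //.
  - by rewrite sumr_const card_ord ltr0n.
  - under eq_bigr do rewrite scale1r /u addrAC subrr add0r.
    by rewrite -scaler_sumr; have [_ -> _] := eP i; rewrite scaler0.
apply/seteqP; split => // -[i k] _.
have [c [c0 cS c1 cv]] := conv_hull_comb (Sv i).
have cuv : \sum_q c q *: (u q - v i) = 0.
  under eq_bigr do rewrite scalerBr.
  by rewrite sumrB cv -scaler_suml c1 scale1r subrr.
have [ew esum eneq] := eP i.
have ci q : q.1 != i -> c q = 0.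
  move=> qi.
  have pos r : 0 <= dot (u r - v i) (w i).
    have [ri|ri] := eqVneq r.1 i.
      by rewrite /u ri addrAC subrr add0r dotZl ew mulr0.
    by rewrite /u addrAC ltW ?Dw.
  have : \sum_r c r * dot (u r - v i) (w i) == 0.
    under eq_bigr do rewrite -dotZl.
    by rewrite -dot_suml cuv dot0l.
  rewrite psumr_eq0 => [/allP/(_ q (mem_index_enum q))/=|r _]; last by rewrite mulr_ge0.
  rewrite mulf_eq0 => /orP[/eqP//|]; rewrite gt_eqF//.
  by rewrite /u addrAC Dw.
apply: cS; apply: (eneq (fun k => c (i, k))).
  by rewrite -(sum_pair_fst ci).
move: cuv; rewrite (sum_pair_fst (i := i)) => [|q /ci ->]; last by rewrite scale0r.
under eq_bigr do rewrite /u /= addrAC subrr add0r scalerA mulrC -scalerA.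
rewrite -scaler_sumr => /eqP; rewrite scaler_eq0 gt_eqF//= => /eqP; exact.
Qed.

End Lower.

(** * The number of sets *)

Theorem lemma3p1 (R : realType) (d m : nat) (hd : (1 <= d)%N) (hm : (2 <= m)%N)
    (p : 'I_m -> 'rV[R]_d) (hp : injective p) :
  let K := conv_hull (range p) in
  let n := nb_extreme_points K in
  (forall X : 'I_(n * d) -> set 'rV[R]_d,
     (forall i, K `<=` conv_hull (X i)) ->
     exists x : 'I_(n * d) -> 'rV[R]_d,
       (forall i, X i (x i)) /\ K `<=` conv_hull (range x))
  /\
  (exists X : 'I_(n * d - 1) -> set 'rV[R]_d,
     (forall i, K `<=` conv_hull (X i)) /\
     ~ (exists x : 'I_(n * d - 1) -> 'rV[R]_d,
          (forall i, X i (x i)) /\ K `<=` conv_hull (range x))).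
Proof.
have [n0 [v [virr vp]]] := exists_irredundant p.
rewrite /= -vp nb_extreme_points_irredundant//.
have n2 : (2 <= n0)%N.
  rewrite ltnNge; apply/negP => /(@conv_hull_range_le1 _ _ _ v).
  rewrite vp => pE.
  have pK i : conv_hull (range p) (p i) by apply: sub_conv_hull; exists i.
  by have /hp/(congr1 val) := pE _ _ (pK (Ordinal (ltnW hm))) (pK (Ordinal hm)).
split.
  move=> X XK.
  have [|i k j|x [xX xv]] := @colourful_cover _ _ _ v (fun i k => X (mxvec_index i k)) hd n2.
  - exact: irredundant_inj.
  - by apply: XK; apply: sub_conv_hull; exists j.
  have [f fK Kf] := curry_mxvec_bij n0 d.
  exists (fun l => x (f l).1 (f l).2); split => [l|].
    by rewrite -{1}(Kf l isT) /=; case: (f l).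
  apply: conv_hull_sub => _ [j _ <-]; apply: conv_hull_mono (xv j).
  move=> _ [i _ [k _ <-]]; exists (mxvec_index i k) => //.
  by have /= -> := fK (i, k) isT.
have [u [uv uS]] := simplices_around hd n2 virr.
exists (fun=> range u); split.
  by move=> _; apply: conv_hull_sub => _ [i _ <-].
move=> [x [xu vx]].
have /choice[s sx] : forall l, exists q, u q = x l.
  by move=> l; have [q _ <-] := xu l; exists q.
have sT : range s = setT.
  apply: uS => i; have : conv_hull (range x) (v i).
    by apply: vx; apply: sub_conv_hull; exists i.
  by apply: conv_hull_mono => _ [l _ <-]; exists (s l) => //; exists l.
have /choice[r rK] : forall q, exists l, s l = q.
  by move=> q; have : range s q by [rewrite sT]; case=> l _ <-; exists l.
have /leq_card := can_inj rK; rewrite card_prod !card_ord leqNgt.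
by rewrite ltn_subrL/= muln_gt0 hd (ltnW n2).
Qed.
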